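(* Let $\Sigma$ be a finite alphabet with at least two symbols. There is no algorithm with oracle access which, for every strongly almost periodic sequence $\omega\in\Sigma^{\mathbb{N}}$ and every almost periodicity regulator $f$ of $\omega$, given oracle access to $\omega$ and $f$, halts and correctly decides whether $\omega$ is periodic.
   Context: A sequence $\omega$ is periodic if there is $T\ge1$ with $\omega(i)=\omega(i+T)$ for all $i\in\mathbb{N}$. Write $\omega[i,j]=\omega(i)\dots\omega(j)$ and $\omega[i,\infty)$ for the suffix starting at $i$; a factor is a nonempty string $\omega[i,j]$. A sequence is strongly almost periodic if for every factor $x$ there is $l$ such that every factor of length $l$ contains an occurrence of $x$. A function $r\colon\mathbb{N}\to\mathbb{N}$ is an almost periodicity regulator of $\omega$ if (1) every string of length $k$ occurring in $\omega$ infinitely many times occurs in every factor of $\omega$ of length $r(k)$, and (2) every string of length $k$ occurring in $\omega$ only finitely many times does not occur in $\omega[r(k),\infty)$. An algorithm with oracle access to $\omega$ and $f$ may query values $\omega(i)$ and $f(i)$. *)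

(* Defs.v *)
From mathcomp Require Import all_boot.

Set Implicit Arguments.
Unset Strict Implicit.
Unset Printing Implicit Defensive.

Section Sequences.

Variable Sigma : eqType.
Implicit Types (w : nat -> Sigma) (x : seq Sigma) (r : nat -> nat).

Definition periodic w : Prop :=
  exists2 T, 1 <= T & forall i, w i = w (i + T).

Definition window w i n : seq Sigma := [seq w j | j <- iota i n].

Definition occurs_at w x i : Prop := window w i (size x) = x.

Definition is_factor w x : Prop := x <> [::] /\ exists i, occurs_at w x i.

(** "Every factor of length [l]" is expressed by quantifying over the windows
    of length [l].  The value [l = 0] is thereby useless rather than vacuously
    good: the empty window does not contain the nonempty string [x]. *)
Definition strongly_almost_periodic w : Prop :=
  forall x, is_factor w x -> exists l, forall i, infix x (window w i l).

Definition occurs_infinitely_often w x : Prop :=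
  forall N, exists2 i, N <= i & occurs_at w x i.

(** For the empty string ([k = 0]) both clauses hold trivially. *)
Definition almost_periodicity_regulator w r : Prop :=
  (forall k x, size x = k -> occurs_infinitely_often w x ->
     forall i, infix x (window w i (r k))) /\
  (forall k x, size x = k -> ~ occurs_infinitely_often w x ->
     forall i, r k <= i -> ~ occurs_at w x i).

End Sequences.

(** Algorithms with oracle access are programs for Minsky register machines (finitely many
    instructions, unbounded natural-number registers) extended with two query
    instructions.  A letter returned by the sequence oracle is represented by
    its rank in the enumeration of the alphabet. *)

Inductive instr : Type :=
  | Inc of nat             (* Inc r: add one to register r *)
  | DecJump of nat & nat   (* DecJump r q: if register r is 0, jump to
                              instruction q; otherwise subtract one from it *)
  | QuerySeq of nat & nat  (* QuerySeq s r: with i the content of register s,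
                              store the code of w(i) in register r *)
  | QueryReg of nat & nat. (* QueryReg s r: with i the content of register s,
                              store f(i) in register r *)

Definition program : Type := seq instr.

(** Program counter and register contents. *)
Definition config : Type := (nat * (nat -> nat))%type.

Definition update (R : nat -> nat) (r v : nat) : nat -> nat :=
  fun j => if j == r then v else R j.

Definition letter_code (Sigma : finType) (a : Sigma) : nat := enum_rank a.

Section Execution.

Variables (Sigma : finType) (p : program).
Variables (w : nat -> Sigma) (f : nat -> nat).

Definition step (c : config) : config :=
  let: (pc, R) := c in
  match onth p pc with
  | None => c
  | Some (Inc r) => (pc.+1, update R r (R r).+1)
  | Some (DecJump r q) =>
      if R r == 0 then (q, R) else (pc.+1, update R r (R r).-1)
  | Some (QuerySeq s r) => (pc.+1, update R r (letter_code (w (R s))))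
  | Some (QueryReg s r) => (pc.+1, update R r (f (R s)))
  end.

Definition initial_config : config := (0, fun=> 0).

(** The machine halts when the program counter leaves the program; the output
    is then read in register 0. *)
Definition halts_with (v : nat) : Prop :=
  exists n, let c := iter n step initial_config in
    size p <= c.1 /\ c.2 0 = v.

End Execution.

(* Main.v *)
Require Import Defs.
From mathcomp Require Import all_boot.
From mathcomp Require Import zify.

Set Implicit Arguments.
Unset Strict Implicit.
Unset Printing Implicit Defensive.

(** Let [ruler i] be the parity of the 2-adic valuation of [i.+1], and let
    [truncated_ruler n] be the same with valuations capped at [n].  The former
    is not periodic, since [T] and [2 * T] have valuations of different parity;
    the latter has period [2 ^ n].  They agree up to position [n], and one
    function [k |-> 2 ^ k.+2 + k] is a regulator of all of them.  A run on
    [ruler] with this regulator queries finitely many letters, so it gives the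
    same answer on [truncated_ruler n] for large [n]. *)

Section Recurrence.

Variables (T : eqType) (gap : nat -> nat).

(** A uniform strong almost periodicity: the bound depends only on the length [k], so [gap] gives
    one regulator for all sequences satisfying it. *)
Definition recurrent_within (w : nat -> T) : Prop :=
  forall k i j, exists2 i', j <= i' <= j + gap k &
    forall t, t < k -> w (i' + t) = w (i + t).

Lemma window_eq (w : nat -> T) (i j n : nat) :
  (forall t, t < n -> w (i + t) = w (j + t)) -> window w i n = window w j n.
Proof.
move=> eqw; rewrite /window -(addn0 i) -(addn0 j) !iotaDl -!map_comp.
by apply/eq_in_map => t; rewrite mem_iota => /andP[_ /eqw].
Qed.

Lemma infix_window (w : nat -> T) (i j k l : nat) :
  j <= i -> i + k <= j + l -> infix (window w i k) (window w j l).
Proof.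
move=> le_ji le_ik; apply/infixP.
exists (window w j (i - j)), (window w (i + k) (j + l - (i + k))).
rewrite /window -!map_cat -iotaD.
rewrite -{2}(subnKC le_ji) -iotaD; congr (map _ (iota _ _)); lia.
Qed.

Variable w : nat -> T.
Hypothesis recw : recurrent_within w.

Lemma recurrent_infix x i j :
  occurs_at w x i -> infix x (window w j (gap (size x) + size x)).
Proof.
move=> xi; have [i' /andP[le_ji' le_i'j] eqw] := recw (size x) i j.
by rewrite -{1}xi -(window_eq eqw) infix_window //; lia.
Qed.

Lemma recurrent_strongly_almost_periodic : strongly_almost_periodic w.
Proof.
move=> x [_ [i xi]]; exists (gap (size x) + size x) => j.
exact: recurrent_infix xi.
Qed.

(** By recurrence a string that occurs once occurs infinitely often, so the second clause only
    concerns strings that never occur. *)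
Lemma recurrent_regulator :
  almost_periodicity_regulator w (fun k => gap k + k).
Proof.
split=> [k x <- infx j | k x _ ninfx i _ xi].
  by have [i _ xi] := infx 0; apply: recurrent_infix xi.
apply: ninfx => N; have [i' /andP[le_Ni' _] eqw] := recw (size x) i N.
by exists i' => //; rewrite /occurs_at (window_eq eqw).
Qed.

End Recurrence.

Section Ruler.

Definition ruler (i : nat) : bool := odd (logn 2 i.+1).

Definition truncated_ruler (n i : nat) : bool := odd (minn n (logn 2 i.+1)).

Lemma truncated_rulerE n i : i <= n -> truncated_ruler n i = ruler i.
Proof.
move=> le_in; rewrite /truncated_ruler (minn_idPr _) //.
by rewrite (leq_trans _ le_in) // -ltnS ltn_logl.
Qed.

Lemma not_periodic_ruler : ~ periodic ruler.
Proof.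
case=> -[//|T] _ /(_ T); rewrite /ruler.
have -> : (T + T.+1).+1 = 2 * T.+1 by rewrite mul2n -addnn addSn.
rewrite lognM // oddD; have -> : logn 2 2 = 1 by [].
by case: (odd _).
Qed.

(** For [d <= e], divisibility by [p ^ d] depends only on the residue modulo [p ^ e]. *)
Lemma minn_logn_mod p e x y : prime p -> 0 < x -> 0 < y ->
  x = y %[mod p ^ e] -> minn e (logn p x) = minn e (logn p y).
Proof.
move=> pr_p; wlog: x y / logn p x <= logn p y => [IH | le_xy] x0 y0 eqxy.
  by case/orP: (leq_total (logn p x) (logn p y)) => le; [|symmetry];
    apply: IH.
apply/eqP; rewrite eqn_leq !leq_min !geq_minl /=.
rewrite (leq_trans (geq_minr _ _) le_xy) /=.
rewrite -pfactor_dvdn // /dvdn.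
have/dvdn_exp2l: minn e (logn p y) <= e by apply: geq_minl.
move=> /(_ p) dvd_e; rewrite -(modn_dvdm x dvd_e) eqxy modn_dvdm //.
by rewrite -/(dvdn _ _) pfactor_dvdn // geq_minr.
Qed.

Lemma periodic_truncated_ruler n : periodic (truncated_ruler n).
Proof.
exists (2 ^ n) => [|i]; first by rewrite expn_gt0.
rewrite /truncated_ruler (@minn_logn_mod 2 n i.+1 (i + 2 ^ n).+1) //.
by rewrite -addSn modnDr.
Qed.

Lemma eq_of_minn m x y : y < m -> minn m x = minn m y -> x = y.
Proof. lia. Qed.

(** The residue fixes the valuation capped at [k]. This suffices if the cap [n] is at most [k], or
    if the valuation is below [k] and hence known exactly. *)
Lemma truncated_ruler_mod n k i i' :
  (n <= k) || ~~ (2 ^ k %| i.+1) -> i' = i %[mod 2 ^ k] ->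
  truncated_ruler n i' = truncated_ruler n i.
Proof.
move=> nk eqi.
have eqk : minn k (logn 2 i'.+1) = minn k (logn 2 i.+1).
  apply: minn_logn_mod => //; apply/eqP.
  by rewrite -(addn1 i) -(addn1 i') eqn_modDr; apply/eqP.
rewrite /truncated_ruler.
case/orP: nk => [le_nk | ]; last rewrite pfactor_dvdn // -ltnNge => lt_k.
  by rewrite -(minn_idPl le_nk) -!minnA eqk.
by rewrite (eq_of_minn lt_k eqk).
Qed.

Lemma exists_mod_ge M a j : 0 < M ->
  exists2 i, j <= i <= j + M & i = a %[mod M].
Proof.
(* Modulo [M], [M.-1] acts as [-1], so the added term is the residue of [a - j]. *)
move=> M0; exists (j + (a + M.-1 * j) %% M).
  by rewrite leq_addr leq_add2l ltnW // ltn_pmod.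
rewrite modnDmr addnCA -mulSn prednK //.
by rewrite addnC mulnC modnMDl.
Qed.

(* A window of length [k] covers at most one multiple of [2 ^ k]; the other
   letters only depend on the position modulo [2 ^ k], and the letter at the
   multiple [2 ^ k * y] can be realized by some [y] congruent to 1 or 2
   modulo 4. *)
Lemma recurrent_truncated_ruler n :
  recurrent_within (fun k => 2 ^ k.+2) (truncated_ruler n).
Proof.
move=> k i j.
have M0 e : 0 < 2 ^ e by rewrite expn_gt0.
have E2 : 2 ^ k.+2 = 4 * 2 ^ k by rewrite !expnS; lia.
have modk a b : a = b %[mod 2 ^ k.+2] -> a = b %[mod 2 ^ k].
  have d : 2 ^ k %| 2 ^ k.+2 by rewrite dvdn_exp2l; lia.
  by move=> eqab; rewrite -(modn_dvdm a d) eqab modn_dvdm.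
have [/hasP[t0 t0k /andP[lt_kn dvd0]] | /hasPn nodvd] :=
    boolP (has (fun t => (k < n) && (2 ^ k %| (i + t).+1)) (iota 0 k)); last first.
  have [i' ji' eqi'] := @exists_mod_ge _ i j (M0 k.+2); exists i' => // t ltk.
  have := nodvd t; rewrite mem_iota ltk negb_and -leqNgt => /(_ isT) nd.
  apply: truncated_ruler_mod nd _.
  by apply/eqP; rewrite eqn_modDr; apply/eqP/modk.
have {}t0k : t0 < k by move: t0k; rewrite mem_iota.
case/dvdnP: (dvd0) => y ey.
(* [b] is chosen so that [b + k] has the parity of the wanted letter. The shift below turns
   [y * 2 ^ k] into [(4 * y + 1 + b) * 2 ^ k], whose valuation is [b + k] as [b.+1] is 1 or 2. *)
pose b := truncated_ruler n (i + t0) != odd k.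
have [i' ji' eqi'] := @exists_mod_ge _ (i + (3 * y + 1 + b) * 2 ^ k) j (M0 k.+2).
exists i' => // t ltk; have [-> | ne_t] := eqVneq t t0; last first.
  apply: (@truncated_ruler_mod n k).
    apply/orP; right; apply: contra ne_t => dvdt.
    have : t = t0 %[mod 2 ^ k].
      apply/eqP; rewrite -(eqn_modDl i.+1) !addSn.
      by move: dvdt dvd0; rewrite /dvdn => /eqP -> /eqP ->.
    by rewrite !modn_small ?(ltn_trans _ (ltn_expl k _)) // => ->.
  apply/eqP; rewrite eqn_modDr; apply/eqP.
  by rewrite (modk _ _ eqi') addnC modnMDl.
have eqx : (i' + t0).+1 = (b.+1) * 2 ^ k %[mod 2 ^ k.+2].
  rewrite -(modnMDl y (b.+1 * 2 ^ k)) -addnS -modnDml eqi' modnDml.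
  by congr (_ %% _); rewrite E2; lia.
have l2 : logn 2 (b.+1 * 2 ^ k) = b + k.
  by rewrite lognM // pfactorK //; case: (b).
have eqm : minn k.+2 (logn 2 (i' + t0).+1) = minn k.+2 (b + k).
  by rewrite -l2; apply: minn_logn_mod => //; rewrite muln_gt0 M0.
have lt_bk : b + k < k.+2 by case: (b).
have eql := eq_of_minn lt_bk eqm.
(* The cap is inactive: [b + k <= k.+1 <= n]. *)
rewrite {1}/truncated_ruler eql (minn_idPr _); last first.
  by apply: leq_trans lt_kn; case: (b).
by rewrite oddD /b; case: (truncated_ruler _ _); case: (odd k).
Qed.

(** The bound does not depend on the cap, so the cap may be taken beyond all positions compared. *)
Lemma recurrent_ruler : recurrent_within (fun k => 2 ^ k.+2) ruler.
Proof.
move=> k i j; have [i' ji' eqw] :=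
  recurrent_truncated_ruler (i + j + 2 ^ k.+2 + k) k i j.
by exists i' => // t ltk; have := eqw t ltk; rewrite !truncated_rulerE //; lia.
Qed.

End Ruler.

Section Machines.

Variables (Sigma : finType) (p : program) (f : nat -> nat).

(** Only [QuerySeq] consults the sequence, at one position per step, so [n] steps read a bounded set
    of positions. *)
Lemma iter_step_local (w : nat -> Sigma) n c :
  exists N, forall w', (forall i, i <= N -> w' i = w i) ->
    iter n (step p w' f) c = iter n (step p w f) c.
Proof.
elim: n => [|n [N IH]]; first by exists 0.
case E: (iter n (step p w f) c) => [pc R].
case Ep: (onth p pc) => [[r|r q|s r|s r]|]; last first.
1-2,4-5: by exists N => w' eqw; rewrite !iterS (IH _ eqw) E /= Ep.
exists (maxn N (R s)) => w' eqw; rewrite !iterS IH => [|i le_iN].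
  by rewrite E /= Ep eqw // leq_maxr.
by apply: eqw; rewrite leq_max le_iN.
Qed.

Variable w : nat -> Sigma.

Lemma iter_step_halted n c :
  size p <= c.1 -> iter n (step p w f) c = c.
Proof.
move=> hc; elim: n => //= n ->; case: c hc => pc R /= hpc.
by rewrite onthE nth_default ?size_map.
Qed.

Lemma halts_with_inj v v' : halts_with p w f v -> halts_with p w f v' -> v = v'.
Proof.
move=> [n [hn <-]] [n' [hn' <-]].
case/orP: (leq_total n n') => le.
  by rewrite -(subnK le) iterD (iter_step_halted _ hn).
by rewrite -(subnK le) iterD (iter_step_halted _ hn').
Qed.

End Machines.

Theorem theorem8 (Sigma : finType) (hSigma : 1 < #|Sigma|) :
  ~ exists p : program,
      forall (w : nat -> Sigma) (f : nat -> nat),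
        strongly_almost_periodic w ->
        almost_periodicity_regulator w f ->
        exists b : bool, halts_with p w f b /\ (b <-> periodic w).
Proof.
case=> p decides; have [a [b [_ _ ne_ab]]] := card_gt1P hSigma.
pose letter (c : bool) := if c then a else b.
have letter_inj : injective letter.
  by move=> [] [] //= /eqP; rewrite ?[b == a]eq_sym (negPf ne_ab).
(* Restricts to boolean sequences coded by two letters, with a fixed regulator; injectivity of
   [letter] carries periodicity back. *)
have {}decides w : recurrent_within (fun k => 2 ^ k.+2) w ->
    exists c : bool, halts_with p (letter \o w) (fun k => 2 ^ k.+2 + k) c /\
      (c <-> periodic w).
  move=> recw.
  have recl : recurrent_within (fun k => 2 ^ k.+2) (letter \o w).
    move=> k i j; have [i' ji' eqw] := recw k i j.
    by exists i' => // t /eqw /= ->.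
  have [c [hc perc]] := decides _ _ (recurrent_strongly_almost_periodic recl)
    (recurrent_regulator recl).
  exists c; split=> //; rewrite perc.
  by split=> -[T T0 per]; exists T => // i; [apply: letter_inj|congr letter];
    apply: per.
have [c [[n [hn outn]] perc]] := decides _ recurrent_ruler.
have [N local] := iter_step_local p (fun k => 2 ^ k.+2 + k) (letter \o ruler)
  n initial_config.
(* Capping at the query bound [N] keeps every letter read before halting but makes the sequence
   periodic. *)
have [c' [hc' perc']] := decides _ (recurrent_truncated_ruler N).
have hc : halts_with p (letter \o truncated_ruler N) (fun k => 2 ^ k.+2 + k) c.
  exists n; rewrite local // => i le_iN.
  by rewrite /= truncated_rulerE.
apply/not_periodic_ruler/perc.
have := halts_with_inj hc hc'; have := (proj2 perc') (periodic_truncated_ruler N).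
by case: (c) (c') => [] [].
Qed.
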